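(* Let $\{x^k\}_{k\in\mathbb{N}}$ be an infinite sequence generated by Variant A.1 of the algorithm described in the context. Then $\{x^k\}_{k\in\mathbb{N}}$ converges to some element belonging to $S^*\cap X$.
   Context: Setting. $\mathbb{R}^n$ carries its inner product $\langle\cdot,\cdot\rangle$ and norm $\|\cdot\|$; $P_C$ is the orthogonal projection onto a nonempty closed convex set $C$; $B[c,r]$ is the closed ball with center $c$ and radius $r$. Let $\mathbb{I}=\{1,\dots,m\}$, $m\in\mathbb{N}$. For $i\in\mathbb{I}$, $A_i:\mathbb{R}^n\to\mathbb{R}^n$ is point-to-point and maximal monotone, $B_i:\mathbb{R}^n\to2^{\mathbb{R}^n}$ is point-to-set and maximal monotone, $\mathrm{dom}(B_i)\subseteq\mathrm{dom}(A_i)$. Let $S_i^*=\{x: 0\in A_i(x)+B_i(x)\}$, $S^*=\bigcap_{i\in\mathbb{I}}S_i^*$. $X\subseteq\bigcap_{i\in\mathbb{I}}\mathrm{dom}(B_i)$ is a nonempty closed convex set with $X\cap S^*\neq\emptyset$. Assumption on $B_i$: for each bounded subset $V$ of $\mathrm{dom}(B_i)$ there exists $R>0$ such that $B_i(x)\cap B[0,R]\ne\emptyset$ for all $x\in V$, $i\in\mathbb{I}$. Parameters: $\{\beta_k\}_{k\in\mathbb{N}}\subseteq[\check\beta,\hat\beta]$ with $0<\check\beta\le\hat\beta<\infty$; $\theta,\delta\in(0,1)$; $R>0$ is a constant provided by this assumption for a bounded set containing the points at which elements of $B_i$ are selected in Step 3, so that those selections are possible. Algorithm (Variant A.1). Step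 0: take $x^0\in X$. Step 1: given $x^k$, compute $J_i(x^k,\beta_k):=(I+\beta_kB_i)^{-1}(I-\beta_kA_i)(x^k)$ for all $i\in\mathbb{I}$. Step 2: let $\mathbb{I}_k^*:=\{i\in\mathbb{I}: x^k=J_i(x^k,\beta_k)\}$; if $\mathbb{I}_k^*=\mathbb{I}$, stop. Step 3 (inner loop): otherwise, for each $i\in\mathbb{I}\setminus\mathbb{I}_k^*$ and successively $j=0,1,2,\dots$, choose any $u^k_{(j,i)}\in B_i\big(\theta^jJ_i(x^k,\beta_k)+(1-\theta^j)x^k\big)\cap B[0,R]$; at the first $j$ for which $\big\langle A_i(\theta^jJ_i(x^k,\beta_k)+(1-\theta^j)x^k)+u^k_{(j,i)},x^k-J_i(x^k,\beta_k)\big\rangle\ge\frac{\delta}{\beta_k}\|x^k-J_i(x^k,\beta_k)\|^2$, set $j_i(k):=j$ and stop the inner loop. Step 4: for $i\in\mathbb{I}\setminus\mathbb{I}_k^*$ set $\alpha_{k,i}:=\theta^{j_i(k)}$, $\bar u_i^k:=u^k_{(j_i(k),i)}$, $\bar x_i^k:=\alpha_{k,i}J_i(x^k,\beta_k)+(1-\alpha_{k,i})x^k$, and set $x^{k+1}:=P_X(P_{H_k}(x^k))$, where $H_i(x,u)=\{y\in\mathbb{R}^n:\langle A_i(x)+u,y-x\rangle\le0\}$ and $H_k=\bigcap_{i\in\mathbb{I}\setminus\mathbb{I}_k^*}H_i(\bar x_i^k,\bar u_i^k)$. Step 5: if $x^{k+1}=x^k$, stop; otherwise replace $k$ by $k+1$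 and go to Step 1. *)

(* Defs.v *)
(* Vectors of R^n are row vectors ['rV[R]_n] over a [realType].  The library
   norm on this type is the max norm; it induces the usual topology and the
   usual bounded sets, so [closed], [bounded_set] and [-->] are taken from the
   library, whereas every metric notion of the algorithm (balls, projections,
   line search) uses the Euclidean norm [enorm]. *)
From HB Require Import structures.
From mathcomp Require Import all_boot all_order all_algebra.
From mathcomp Require Import all_classical all_reals all_analysis.

Set Implicit Arguments.
Unset Strict Implicit.
Unset Printing Implicit Defensive.

Import Order.TTheory GRing.Theory Num.Theory.
Import numFieldNormedType.Exports.

Local Open Scope classical_set_scope.
Local Open Scope ring_scope.

Section Euclidean.
Context {R : realType} {n : nat}.
Local Notation V := 'rV[R]_n.
Implicit Types (x y p c : V) (C : set V).

Definition dot x y : R := \sum_(i < n) x 0 i * y 0 i.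

Definition enorm x : R := Num.sqrt (dot x x).

Definition eball c (r : R) : set V := [set y | enorm (y - c) <= r].

(* [is_proj C x p] is the graph of the orthogonal projection: p = P_C(x). *)
Definition is_proj C x p : Prop :=
  C p /\ forall y, C y -> enorm (x - p) <= enorm (x - y).

End Euclidean.

Section Operators.
Context {R : realType} {n : nat}.
Local Notation V := 'rV[R]_n.
Implicit Types (S T : V -> set V) (D : set V) (f : V -> V).

Definition dom T : set V := [set x | T x !=set0].

(* A point-to-point operator may have a domain D other than the whole space;
   outside D the values of f are irrelevant. *)
Definition pt_op D f : V -> set V := fun x => [set y | D x /\ y = f x].

Definition op_id : V -> set V := fun x => [set x].

Definition op_add S T : V -> set V :=
  fun x => [set a + b | a in S x & b in T x].

Definition op_scale (b : R) T : V -> set V :=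
  fun x => [set b *: v | v in T x].

Definition op_inv T : V -> set V := fun y => [set x | T x y].

Definition zeros T : set V := [set x | T x 0].

Definition monotone_op T : Prop :=
  forall x y u v, T x u -> T y v -> 0 <= dot (x - y) (u - v).

Definition maximal_monotone T : Prop :=
  monotone_op T /\
  forall T', monotone_op T' -> (forall x, T x `<=` T' x) -> T' = T.

Definition selection_radius T (W : set V) (rho : R) : Prop :=
  0 < rho /\ forall x, W x -> (T x `&` eball 0 rho) !=set0.

Definition bounded_selection T : Prop :=
  forall W, bounded_set W -> W `<=` dom T ->
  exists rho, selection_radius T W rho.

(* J(x, b) = (I + b B)^{-1} (I - b A) (x), as a set. *)
Definition fwd_bwd f T (b : R) (x : V) : set V :=
  op_inv (op_add op_id (op_scale b T)) (x - b *: f x).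

Definition halfspace f (x u : V) : set V :=
  [set y | dot (f x + u) (y - x) <= 0].

End Operators.

Section Algorithm.
Context {R : realType} {n m : nat}.
Local Notation V := 'rV[R]_n.
Variables (A : 'I_m -> V -> V) (B : 'I_m -> V -> set V) (X : set V).
Variables (beta : nat -> R) (theta delta rho : R).
(* x k, J k i, j k i and u k l i stand for x^k, J_i(x^k, beta_k), j_i(k) and
   u^k_(l,i); u k l i only matters for l <= j k i. *)
Variables (x : nat -> V) (J : nat -> 'I_m -> V) (j : nat -> 'I_m -> nat).
Variable (u : nat -> nat -> 'I_m -> V).

Definition fixed_idx (k : nat) : set 'I_m := [set i | x k = J k i].

Definition trial (k l : nat) (i : 'I_m) : V :=
  theta ^+ l *: J k i + (1 - theta ^+ l) *: x k.

Definition accepted (k l : nat) (i : 'I_m) : Prop :=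
  delta / beta k * enorm (x k - J k i) ^+ 2 <=
  dot (A i (trial k l i) + u k l i) (x k - J k i).

Definition separating_set (k : nat) : set V :=
  \bigcap_(i in ~` fixed_idx k)
    halfspace (A i) (trial k (j k i) i) (u k (j k i) i).

(* The run is infinite: neither stopping test ever succeeds, and every inner
   loop terminates. *)
Record variantA1_run : Prop := VariantA1Run {
  run_start : X (x 0%N);
  run_fwd_bwd : forall k i, fwd_bwd (A i) (B i) (beta k) (x k) (J k i);
  run_nostop_idx : forall k, fixed_idx k <> setT;
  run_select : forall k i l, (~` fixed_idx k) i -> (l <= j k i)%N ->
    (B i (trial k l i) `&` eball 0 rho) (u k l i);
  run_reject : forall k i l, (~` fixed_idx k) i -> (l < j k i)%N ->
    ~ accepted k l i;
  run_accept : forall k i, (~` fixed_idx k) i -> accepted k (j k i) i;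
  run_next : forall k, exists2 z,
    is_proj (separating_set k) (x k) z & is_proj X z (x k.+1);
  run_nostop_eq : forall k, x k.+1 <> x k
}.

(* rho is a radius provided by [bounded_selection], for bounded sets W i that
   contain the points where elements of B i are selected. *)
Definition admissible_radius : Prop :=
  exists W : 'I_m -> set V, forall i,
    [/\ bounded_set (W i), W i `<=` dom (B i), selection_radius (B i) (W i) rho
      & forall k l, (~` fixed_idx k) i -> (l <= j k i)%N -> W i (trial k l i)].

End Algorithm.

(* Main.v *)
Require Import Defs.
From mathcomp Require Import all_boot all_order all_algebra.
From mathcomp Require Import all_classical all_reals all_analysis.
From mathcomp Require Import ring lra.
Import Order.TTheory GRing.Theory Num.Theory.
Import numFieldNormedType.Exports.
Local Open Scope classical_set_scope.
Local Open Scope ring_scope.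

Set Implicit Arguments.
Unset Strict Implicit.
Unset Printing Implicit Defensive.

(** The sequence is Fejer monotone with respect to the common solution set:
    every common solution lying in X belongs to all the half-spaces, because
    A_i + B_i is monotone, so neither of the two projections that produce the
    next iterate can increase the distance to it ([run_step_fejer]).  Hence
    the iterates are bounded, and the distance from x^k to its projection z^k
    onto H_k tends to 0, being controlled by the decrease of a convergent
    sequence.  A Fejer monotone sequence converges as soon as one of its
    cluster points is a common solution in X, so everything rests on
    [run_cluster_zero]: every cluster point xs of the sequence is a zero of
    each A_i + B_i.

    Fix i.  All the auxiliary sequences (stepsizes, J_i, line-search points,
    selections u) are bounded and must be made to converge together; this is
    done with an ultrafilter F on the indices finer than the filter at
    infinity.  Along F every bounded sequence converges, and every property of
    the indices holds for F-almost all of them or fails for F-almost all of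
    them, so that no subsequence is ever extracted.  If beta_k tends to beta
    along F, then J_i(x^k, beta_k) tends to some yl ([resolvent_cvg]), and
    (xs - beta A_i(xs) - yl) / beta belongs to B_i(yl) because maximal
    monotone graphs are closed.  It remains to see yl = xs.
    - If x^k = J_i(x^k, beta_k) for F-almost all k, this equality passes to
      the limit.
    - If the steps theta^j_i(k) tend to 0, the trial just before the accepted
      one was rejected, and its point tends to xs.  The rejection inequality
      at the limit contradicts monotonicity of B_i, with the gap 1 - delta,
      unless yl = xs ([rejected_fixed]).
    - If the steps have a positive limit al, acceptance together with
      z^k in H_k bounds al * delta * |x^k - J_i|^2 by a multiple of
      the inner product of a bounded vector with x^k - z^k, which tends to 0.

    Each of these limits uses that A_i is continuous along the points
    involved.  This comes from maximality alone, whatever the domain of A_i: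
    a maximal monotone operator is continuous at any point where it is
    single-valued ([maximal_monotone_continuous]).  The points in question
    have their limit in the domain of B_i, hence of A_i, by closedness of the
    graph of B_i. *)

(** * Euclidean geometry *)

Section EuclideanSpace.
Context {R : realType} {n : nat}.
Local Notation V := 'rV[R]_n.
Implicit Types (x y z : V) (C : set V).

Lemma dotC x y : dot x y = dot y x.
Proof. by apply: eq_bigr => i _; rewrite mulrC. Qed.

Lemma dotDl x y z : dot (x + y) z = dot x z + dot y z.
Proof. by rewrite -big_split; apply: eq_bigr => i _; rewrite mxE mulrDl. Qed.

Lemma dotDr x y z : dot z (x + y) = dot z x + dot z y.
Proof. by rewrite !(dotC z) dotDl. Qed.

Lemma dotZl a x z : dot (a *: x) z = a * dot x z.
Proof. by rewrite mulr_sumr; apply: eq_bigr => i _; rewrite mxE mulrA. Qed.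

Lemma dotZr a x z : dot z (a *: x) = a * dot z x.
Proof. by rewrite !(dotC z) dotZl. Qed.

Lemma dotNl x z : dot (- x) z = - dot x z.
Proof. by rewrite -scaleN1r dotZl mulN1r. Qed.

Lemma dotNr x z : dot z (- x) = - dot z x.
Proof. by rewrite !(dotC z) dotNl. Qed.

Definition dotE := (dotDl, dotDr, dotNl, dotNr, dotZl, dotZr).

Lemma dot_ge0 x : 0 <= dot x x.
Proof. by apply: sumr_ge0 => i _; rewrite -expr2 sqr_ge0. Qed.

Lemma coord_sqr_le_dot x i : x 0 i ^+ 2 <= dot x x.
Proof.
rewrite /dot (bigD1 i)//= -expr2 lerDl.
by apply: sumr_ge0 => k _; rewrite -expr2 sqr_ge0.
Qed.

Lemma dot_le0_eq0 x : dot x x <= 0 -> x = 0.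
Proof.
move=> x0; apply/rowP => i; rewrite mxE; apply/eqP.
by rewrite -sqrf_eq0 eq_le sqr_ge0 andbT (le_trans (coord_sqr_le_dot x i)).
Qed.

(** The norm of row vectors is the max norm, so Euclidean smallness implies
    topological smallness. *)
Lemma norm_le_dot x (e : R) : 0 <= e -> dot x x <= e ^+ 2 -> `|x| <= e.
Proof.
move=> e0 xe; rewrite /Num.norm/= mx_normrE.
apply/bigmax_leP; split=> // -[i k] _ /=; rewrite (ord1 i).
rewrite -(@ler_pXn2r _ 2)// ?nnegrE// real_normK ?num_real//.
exact: le_trans (coord_sqr_le_dot x k) xe.
Qed.

Lemma enorm_sqr x : enorm x ^+ 2 = dot x x.
Proof. by rewrite sqr_sqrtr ?dot_ge0. Qed.

Lemma enorm_le x y : (enorm x <= enorm y) = (dot x x <= dot y y).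
Proof. by rewrite ler_sqrt ?dot_ge0. Qed.

Lemma enorm_le_sqr x (r : R) : enorm x <= r -> dot x x <= r ^+ 2.
Proof.
move=> xr; rewrite -enorm_sqr ler_pXn2r ?nnegrE ?sqrtr_ge0//.
exact: le_trans (sqrtr_ge0 _) xr.
Qed.

(** Variational inequality of the projection: moving from p towards y stays
    in C and cannot decrease the distance to x, so the derivative of the
    squared distance at p in the direction y - p is nonnegative.  Only the
    segment from p to y has to lie in C. *)
Lemma is_proj_obtuse C x p y :
  (forall t, 0 < t < 1 -> C (t *: y + (1 - t) *: p)) ->
  is_proj C x p -> dot (x - p) (y - p) <= 0.
Proof.
move=> Cpy [Cp pmin].
have ineq t : 0 < t < 1 -> 2 * dot (x - p) (y - p) <= t * dot (y - p) (y - p).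
  move=> t01; have [t0 _] := andP t01.
  have := pmin _ (Cpy t t01); rewrite enorm_le.
  have -> : x - (t *: y + (1 - t) *: p) = (x - p) - t *: (y - p).
    by apply/rowP => i; rewrite !mxE; ring.
  move: (x - p) (y - p) => v w; rewrite !dotE (dotC w v).
  move=> h; rewrite -(ler_pM2l t0); lra.
rewrite leNgt; apply/negP => d0.
have q0 := dot_ge0 (y - p).
set d := dot (x - p) (y - p) in ineq d0.
set q := dot (y - p) (y - p) in ineq q0.
have s0 : 0 < d + q + 1 by lra.
(* A step below d / q, and below 1, contradicts ineq. *)
have t01 : 0 < d / (d + q + 1) < 1.
  by apply/andP; split; [exact: divr_gt0 | rewrite ltr_pdivrMr// mul1r; lra].
have := ineq _ t01; rewrite mulrAC ler_pdivlMr//; nra.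
Qed.

Lemma is_proj_fejer C x p y :
  (forall t, 0 < t < 1 -> C (t *: y + (1 - t) *: p)) -> is_proj C x p ->
  dot (p - y) (p - y) + dot (x - p) (x - p) <= dot (x - y) (x - y).
Proof.
move=> Cpy /(is_proj_obtuse Cpy).
have -> : x - y = (x - p) - (y - p) by apply/rowP => i; rewrite !mxE; ring.
rewrite -(opprB y p); move: (x - p) (y - p) => v w.
rewrite !dotE (dotC w v); lra.
Qed.

Lemma convex_set_segment C x y t : convex_set C -> C x -> C y -> 0 < t < 1 ->
  C (t *: x + (1 - t) *: y).
Proof.
move=> /convex_setW Ccvx Cx Cy /andP[t0 t1].
have t01 : 0 <= t <= 1 by rewrite !ltW.
pose k := Itv01 (ltW t0) (ltW t1).
have := Ccvx x y (mem_set Cx) (mem_set Cy) k t0 t1.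
by move=> /set_mem.
Qed.

End EuclideanSpace.

(** * Limits along ultrafilters *)

Section UltrafilterLimits.
Context {R : realType} {n : nat}.
Local Notation V := 'rV[R]_n.
Variable F : set_system nat.

Lemma dot_cvg {FF : Filter F} (f g : nat -> V) (a b : V) :
  f @ F --> a -> g @ F --> b -> dot (f k) (g k) @[k --> F] --> dot a b.
Proof.
move=> fa gb; apply: (@cvg_big R 'I_n +%R 0 xpredT _ nat F _
  (fun i k => f k 0 i * g k 0 i) (fun i => a 0 i * b 0 i)) => [|i _].
  exact: add_continuous.
apply: cvgM.
  exact: (continuous_cvg _ (@coord_continuous R 1 n 0 i a) fa).
exact: (continuous_cvg _ (@coord_continuous R 1 n 0 i b) gb).
Qed.

(** Compactness gives a cluster point; along an ultrafilter a preimage which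
    meets every set of F belongs to F, so a cluster point is a limit. *)
Lemma ultra_compact_cvg {FU : UltraFilter F} {T : topologicalType}
    (K : set T) (f : nat -> T) :
  compact K -> (\forall k \near F, K (f k)) -> exists2 l, K l & f @ F --> l.
Proof.
move=> cK FK; have [l [Kl lF]] := cK (f @ F) _ FK.
exists l => // U Ul.
have [//|FnU] := in_ultra_setVsetC (f @^-1` U) FU.
by have [y [nUy Uy]] := lF (~` U) U FnU Ul.
Qed.

Lemma ultra_itv_cvg {FU : UltraFilter F} (f : nat -> R) (a b : R) :
  (\forall k \near F, a <= f k <= b) ->
  exists2 l, a <= l <= b & f @ F --> l.
Proof.
move=> fab; have [||l lab fl] := @ultra_compact_cvg _ _ `[a, b]%classic f.
- exact: segment_compact.
- by apply: filterS fab => k; rewrite /= in_itv.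
- by exists l.
Qed.

Lemma ultra_bounded_cvg {FU : UltraFilter F} (v : nat -> V) (M : R) :
  (\forall k \near F, dot (v k) (v k) <= M) -> exists l : V, v @ F --> l.
Proof.
move=> vM.
have [||l _ vl] := @ultra_compact_cvg _ V
  [set w : V | forall i, `[- (1 + M), 1 + M]%classic (w ord0 i)] v;
  last by exists l.
- by apply: (@rV_compact _ _ (fun=> `[- (1 + M), 1 + M]%classic)) => _;
    exact: segment_compact.
- apply: filterS vM => k kM i /=; rewrite in_itv/=.
  have := le_trans (coord_sqr_le_dot (v k) i) kM.
  by move=> h; apply/andP; split; nra.
Qed.

End UltrafilterLimits.

(** * Maximal monotone operators *)

Section MonotoneOperators.
Context {R : realType} {n : nat}.
Local Notation V := 'rV[R]_n.
Implicit Types (T : V -> set V) (x y v w : V).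

(** Otherwise adding the pair (x, v) to the graph would give a strictly larger
    monotone operator. *)
Lemma maximal_monotone_mem T x v : maximal_monotone T ->
  (forall y w, T y w -> 0 <= dot (x - y) (v - w)) -> T x v.
Proof.
move=> [Tmon Tmax] xv.
pose T' y := T y `|` [set w | y = x /\ w = v].
suff <- : T' = T by right.
apply: Tmax => [y1 y2 w1 w2|y w Tyw]; last by left.
case=> [T1|[-> ->]]; case=> [T2|[-> ->]].
- exact: Tmon.
- by rewrite -(opprB x) -(opprB v) dotNl dotNr opprK; exact: xv.
- exact: xv.
- by rewrite subrr -(scale0r v) dotZl mul0r.
Qed.

Lemma maximal_monotone_closed T x v (xs vs : nat -> V) (F : set_system nat)
    {FF : ProperFilter F} :
  maximal_monotone T -> (\forall k \near F, T (xs k) (vs k)) ->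
  xs @ F --> x -> vs @ F --> v -> T x v.
Proof.
move=> Tmax Txv xsx vsv; apply: maximal_monotone_mem => // y w Tyw.
have lim : dot (xs k - y) (vs k - w) @[k --> F] --> dot (x - y) (v - w).
  by apply: dot_cvg; apply: cvgB => //; exact: cvg_cst.
apply: (ler_cvg_to (cvg_cst 0) lim).
by apply: filterS Txv => k Tk; apply: Tmax.1.
Qed.

(** By closedness of the graph it is enough to exclude that vs is unbounded
    along F.  In that case the limit dl of the normalized values would satisfy
    0 <= <x - y, dl> on the whole domain, that is, dl would be a normal vector
    to the domain at x; then v + dl would again be a value at x, so dl = 0,
    although dl has norm 1. *)
Lemma maximal_monotone_continuous T x v (xs vs : nat -> V)
    (F : set_system nat) {FU : UltraFilter F} :
  maximal_monotone T -> T x = [set v] ->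
  (\forall k \near F, T (xs k) (vs k)) -> xs @ F --> x -> vs @ F --> v.
Proof.
move=> Tmax Tx Txv xsx.
(* The limit cl of c is 0 exactly when vs is unbounded along F; the vectors
   c k *: vs k stay in the unit ball in all cases. *)
pose c k := (1 + enorm (vs k))^-1.
have e0 k : 0 < 1 + enorm (vs k) by rewrite ltr_pwDl// sqrtr_ge0.
have c0 k : 0 < c k by rewrite invr_gt0.
have ce k : c k * enorm (vs k) = 1 - c k.
  by rewrite -[1 in RHS](mulVf (lt0r_neq0 (e0 k))) -/(c k) mulrDr mulr1; ring.
have c1 k : c k <= 1.
  by rewrite -subr_ge0 -ce mulr_ge0 ?sqrtr_ge0 ?ltW.
have [|cl _ ccl] := @ultra_itv_cvg _ F _ c 0 1.
  by near=> k; rewrite c1 ltW.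
pose d k := c k *: vs k.
have dd k : dot (d k) (d k) = (1 - c k) ^+ 2.
  by rewrite -ce exprMn enorm_sqr /d !dotE mulrA.
have [|dl ddl] := @ultra_bounded_cvg _ _ F _ d 1.
  by near=> k; rewrite dd; have := c1 k; have := c0 k; nra.
have mono y w : T y w -> 0 <= dot (x - y) (dl - cl *: w).
  move=> Tyw.
  have lim : dot (xs k - y) (d k - c k *: w) @[k --> F] -->
             dot (x - y) (dl - cl *: w).
    apply: dot_cvg; apply: cvgB => //; first exact: cvg_cst.
    by apply: cvgZ => //; exact: cvg_cst.
  apply: (ler_cvg_to (cvg_cst 0) lim).
  apply: filterS Txv => k Tk.
  by rewrite -scalerBr dotZr (mulr_ge0 (ltW (c0 k)))//; apply: Tmax.1.
have Txv0 : T x v by rewrite Tx.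
have [cl_eq0|cl_neq0] := eqVneq cl 0.
  have Tdv : T x (v + dl).
    apply: maximal_monotone_mem => // y w Tyw.
    have := mono _ _ Tyw; rewrite cl_eq0 scale0r subr0 => h.
    rewrite addrAC dotDr addr_ge0//.
    exact: (Tmax.1 _ _ _ _ Txv0 Tyw).
  have dl0 : dl = 0.
    by move: Tdv; rewrite Tx => /= /eqP; rewrite -subr_eq0 addrAC subrr add0r
      => /eqP.
  have dd0 : dot (d k) (d k) @[k --> F] --> dot dl dl by exact: dot_cvg.
  have dd1 : dot (d k) (d k) @[k --> F] --> (1 - cl) ^+ 2.
    under eq_cvg do rewrite dd expr2; rewrite expr2.
    by apply: cvgM; apply: cvgB => //; exact: cvg_cst.
  have /eqP : (1 - cl) ^+ 2 = dot dl dl.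
    exact: (cvg_unique (@Rhausdorff R) dd1 dd0).
  by rewrite dl0 -(scale0r dl) dotZl cl_eq0 subr0 expr1n mul0r oner_eq0.
have vslim : vs @ F --> cl^-1 *: dl.
  have -> : vs = (fun k => (c k)^-1 *: d k).
    by apply/funext => k; rewrite scalerA mulVf ?scale1r// gt_eqF.
  by apply: cvgZ => //; exact: cvgV.
have Tlim : T x (cl^-1 *: dl).
  by apply: (maximal_monotone_closed Tmax Txv xsx vslim).
by move: Tlim; rewrite Tx => /= <-.
Unshelve. all: by end_near. Qed.

Lemma single_valued_continuous (D : set V) (f : V -> V) (T : V -> set V)
    (y v : nat -> V) (yl vl : V) (F : set_system nat) {FU : UltraFilter F} :
  maximal_monotone (pt_op D f) -> dom T `<=` D ->
  (\forall k \near F, T (y k) (v k)) -> T yl vl -> y @ F --> yl ->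
  f \o y @ F --> f yl.
Proof.
move=> fmax TD Tyv Tl yyl; apply: (maximal_monotone_continuous fmax _ _ yyl).
  apply/seteqP; split=> w; first by case.
  by move=> ->; split=> //; apply: TD; exists vl.
by apply: filterS Tyv => k Tk; split=> //; apply: TD; exists (v k).
Qed.

(** Limits of the implicit step y + b T(y) = p.  Comparing with a fixed pair
    (s, v) of the graph, monotonicity gives
    |y - s| <= |p - s - b v|, hence boundedness of y. *)
Lemma resolvent_cvg T s v (b : nat -> R) (p y : nat -> V) (bl : R) (pl : V)
    (F : set_system nat) {FU : UltraFilter F} :
  maximal_monotone T -> T s v -> 0 < bl -> b @ F --> bl -> p @ F --> pl ->
  (\forall k \near F, T (y k) ((b k)^-1 *: (p k - y k))) ->
  exists2 yl, y @ F --> yl & T yl (bl^-1 *: (pl - yl)).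
Proof.
move=> Tmax Tsv bl0 bbl ppl Ty.
have bgt0 : \forall k \near F, 0 < b k by exact: cvgr_gt bbl _ bl0.
have bound : \forall k \near F, dot (y k - s) (y k - s) <=
    dot (p k - s - b k *: v) (p k - s - b k *: v).
  near=> k.
  have bk0 : 0 < b k by near: k.
  have Tk : T (y k) ((b k)^-1 *: (p k - y k)) by near: k.
  have := Tmax.1 _ _ _ _ Tk Tsv.
  rewrite -(pmulr_rge0 _ bk0) -dotZr scalerBr scalerA divff ?gt_eqF// scale1r.
  have -> : p k - y k - b k *: v = (p k - s - b k *: v) - (y k - s).
    by apply/rowP => i; rewrite !mxE; ring.
  move: (y k - s) (p k - s - b k *: v) => a c.
  (* 0 <= <c - a, a> and 2 <c, a> <= |c|^2 + |a|^2. *)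
  have := dot_ge0 (a - c); rewrite !dotE (dotC c a); lra.
have qlim : (fun k => p k - s - b k *: v) @ F --> pl - s - bl *: v.
  apply: cvgB; first by apply: cvgB => //; exact: cvg_cst.
  by apply: cvgZ => //; exact: cvg_cst.
have [|l yl] := @ultra_bounded_cvg _ _ F _ (fun k => y k - s)
    (dot (pl - s - bl *: v) (pl - s - bl *: v) + 1).
  have : \forall k \near F, dot (p k - s - b k *: v) (p k - s - b k *: v) <=
      dot (pl - s - bl *: v) (pl - s - bl *: v) + 1.
    by apply: cvgr_le (dot_cvg qlim qlim) _ _; rewrite ltrDl.
  by apply: filterS2 bound => k; exact: le_trans.
have ys : y @ F --> l + s.
  have -> : y = (fun k => y k - s + s) by apply/funext => k; rewrite subrK.
  by apply: cvgD => //; exact: cvg_cst.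
exists (l + s) => //.
apply: (maximal_monotone_closed Tmax Ty ys).
apply: cvgZ; first by apply: cvgV; rewrite ?gt_eqF.
exact: (cvgB ppl ys).
Unshelve. all: by end_near. Qed.

Lemma fwd_bwd_graph (f : V -> V) T (b : R) x y : b != 0 ->
  fwd_bwd f T b x y -> T y (b^-1 *: (x - b *: f x - y)).
Proof.
move=> b0 [_ -> [_ [v Tyv <-] <-]].
by rewrite addrAC subrr add0r scalerA mulVf// scale1r.
Qed.

Lemma zerosP (D : set V) (f : V -> V) T x : dom T `<=` D ->
  zeros (op_add (pt_op D f) T) x <-> T x (- f x).
Proof.
move=> TD; split=> [[_ [_ ->] [v Tv] /eqP]|Tx].
  by rewrite addrC addr_eq0 => /eqP <-.
exists (f x); first by split=> //; apply: TD; exists (- f x).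
by exists (- f x) => //; rewrite subrr.
Qed.

(** Monotonicity of T between x and y, multiplied by b, reads
    |x - y|^2 <= b <a + u, x - y>, so a line search with factor delta < 1
    accepts arbitrarily short steps unless x = y. *)
Lemma rejected_fixed (T : V -> set V) (a u x y : V) (b delta : R) :
  monotone_op T -> 0 < b -> delta < 1 ->
  T y (b^-1 *: (x - b *: a - y)) -> T x u ->
  b * dot (a + u) (x - y) <= delta * dot (x - y) (x - y) -> y = x.
Proof.
move=> Tmon b0 d1 Ty Tx rej.
have := Tmon _ _ _ _ Tx Ty; rewrite -(pmulr_rge0 _ b0) -dotZr scalerBr scalerA.
rewrite divff ?gt_eqF// scale1r.
have -> : b *: u - (x - b *: a - y) = b *: (a + u) - (x - y).
  by apply/rowP => i; rewrite !mxE; ring.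
rewrite dotDr dotNr dotZr (dotC _ (a + u)) => acc.
apply/esym/eqP; rewrite -subr_eq0; apply/eqP/dot_le0_eq0.
have := dot_ge0 (x - y); nra.
Qed.

End MonotoneOperators.

(** * The iterates *)

Section Run.
Context {R : realType} {n m : nat}.
Local Notation V := 'rV[R]_n.
Variables (A : 'I_m -> V -> V) (B : 'I_m -> V -> set V) (X : set V).
Variables (beta : nat -> R) (bmin bmax theta delta rho : R).
Variables (x : nat -> V) (J : nat -> 'I_m -> V) (j : nat -> 'I_m -> nat).
Variable (u : nat -> nat -> 'I_m -> V).

(** Two projections in a row, each of them onto a convex set containing s. *)
Lemma run_step_fejer s k z : convex_set X -> (forall i, monotone_op (B i)) ->
  (forall i y v, B i y v -> 0 <= dot (s - y) (A i s - A i y)) ->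
  X s -> (forall i, B i s (- A i s)) ->
  variantA1_run A B X beta theta delta rho x J j u ->
  is_proj (separating_set A theta x J j u k) (x k) z -> is_proj X z (x k.+1) ->
  dot (x k.+1 - s) (x k.+1 - s) + dot (x k - z) (x k - z) <=
  dot (x k - s) (x k - s).
Proof.
move=> Xcvx Bmon Amon Xs Bs run zproj xproj.
have Xseg t : 0 < t < 1 -> X (t *: s + (1 - t) *: x k.+1).
  by apply: convex_set_segment => //; case: xproj.
have sH : separating_set A theta x J j u k s.
  move=> i ki /=; have [Bu _] := run_select run ki (leqnn (j k i)).
  have := addr_ge0 (Amon _ _ _ Bu) (Bmon _ _ _ _ _ (Bs i) Bu).
  rewrite -dotDr addrACA subrr add0r -opprD dotNr dotC oppr_ge0.
  by [].
have Hseg t : 0 < t < 1 ->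
    separating_set A theta x J j u k (t *: s + (1 - t) *: z).
  move=> /andP[t0 t1] i ki /=.
  have Hs : dot _ _ <= 0 := sH i ki; have Hz : dot _ _ <= 0 := zproj.1 i ki.
  rewrite /halfspace/=; set q := trial _ _ _ _ _ _ in Hs Hz *.
  have -> : t *: s + (1 - t) *: z - q = t *: (s - q) + (1 - t) *: (z - q).
    by apply/rowP => l; rewrite !mxE; ring.
  rewrite dotDr !dotZr; nra.
have := is_proj_fejer Xseg xproj; have := is_proj_fejer Hseg zproj.
have := dot_ge0 (z - x k.+1); lra.
Qed.

(** Cluster points are described as limits along an ultrafilter F, which then
    makes all the bounded auxiliary sequences converge.  With yl the limit of
    J, the inclusion at yl becomes the conclusion as soon as yl = xs. *)
Lemma run_cluster_zero (D : set V) (i : 'I_m) (z : nat -> V) (xs vs : V)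
    (F : set_system nat) {FU : UltraFilter F} :
  maximal_monotone (pt_op D (A i)) -> maximal_monotone (B i) ->
  dom (B i) `<=` D -> (forall k, dom (B i) (x k)) -> B i xs vs ->
  0 < bmin -> (forall k, bmin <= beta k <= bmax) ->
  0 < theta < 1 -> 0 < delta < 1 ->
  variantA1_run A B X beta theta delta rho x J j u ->
  (forall k, separating_set A theta x J j u k (z k)) ->
  x @ F --> xs -> z @ F --> xs -> B i xs (- A i xs).
Proof.
move=> Amax Bmax BD Bx Bxs bmin0 bb /andP[th0 th1] /andP[de0 de1] run zH xF zF.
have b0 k : 0 < beta k by have /andP[+ _] := bb k; exact: lt_le_trans.
have AxF : (fun k => A i (x k)) @ F --> A i xs.
  have [w Bw] := choice Bx.
  apply: (single_valued_continuous (v := w) Amax BD _ Bxs xF).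
  by near=> k.
have [|bl /andP[bl_min _] bF] := @ultra_itv_cvg _ F _ beta bmin bmax.
  by near=> k.
have bl0 : 0 < bl by exact: lt_le_trans bl_min.
have BJ k : B i (J k i) ((beta k)^-1 *: (x k - beta k *: A i (x k) - J k i)).
  exact: fwd_bwd_graph (lt0r_neq0 (b0 k)) (run_fwd_bwd run k i).
have pF : (fun k => x k - beta k *: A i (x k)) @ F --> xs - bl *: A i xs.
  by apply: cvgB => //; exact: cvgZ.
have [|yl JF Byl] := resolvent_cvg (y := fun k => J k i) Bmax Bxs bl0 bF pF.
  by near=> k.
suff ylxs : yl = xs.
  move: Byl; rewrite ylxs addrAC subrr add0r scalerN scalerA mulVf ?gt_eqF//.
  by rewrite scale1r.
have [fixF|] := in_ultra_setVsetC [set k | x k = J k i] FU.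
  have xyl : x @ F --> yl.
    apply: cvg_trans JF; apply: near_eq_cvg.
    by apply: filterS fixF => k /= ->.
  exact: (cvg_unique (@norm_hausdorff _ _) xyl xF).
move=> nfix; have nfixF : \forall k \near F, (~` fixed_idx x J k) i.
  by apply: filterS nfix.
have dF : (fun k => x k - J k i) @ F --> xs - yl by exact: cvgB.
have trialF (l : nat -> nat) (al : R) :
    (theta ^+ l k) @[k --> F] --> al ->
    (fun k => trial theta x J k (l k) i) @ F --> al *: yl + (1 - al) *: xs.
  move=> alF; apply: cvgD; apply: cvgZ => //.
  by apply: cvgB => //; exact: cvg_cst.
have selF (l : nat -> nat) : (\forall k \near F, (l k <= j k i)%N) ->
    (\forall k \near F, B i (trial theta x J k (l k) i) (u k (l k) i)) /\
    exists ul : V, (fun k => u k (l k) i) @ F --> ul.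
  move=> lj.
  have sel : \forall k \near F,
      (B i (trial theta x J k (l k) i) `&` eball 0 rho) (u k (l k) i).
    by apply: filterS2 nfixF lj => k kn lk; exact: (run_select run kn lk).
  split; first by apply: filterS sel => k [].
  apply: (@ultra_bounded_cvg _ _ _ _ _ (rho ^+ 2)).
  by apply: filterS sel => k [_]; rewrite /eball/= subr0; exact: enorm_le_sqr.
have [|al /andP[al0 _] alF] :=
  @ultra_itv_cvg _ F _ (fun k => theta ^+ j k i) 0 1.
  by near=> k; rewrite exprn_ge0 ?exprn_ile1 ?ltW.
have [al_eq0|al_neq0] := eqVneq al 0.
  have j_gt0 : \forall k \near F, (0 < j k i)%N.
    have : \forall k \near F, theta ^+ j k i < 1.
      by apply: cvgr_lt alF _ _; rewrite al_eq0.
    by apply: filterS => k; case: (j k i) => //; rewrite expr0 ltxx.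
  (* The last rejected trial. *)
  pose l k := (j k i).-1.
  have lF : (theta ^+ l k) @[k --> F] --> (0 : R).
    have : theta^-1 * theta ^+ j k i @[k --> F] --> theta^-1 * al.
      by apply: cvgM => //; exact: cvg_cst.
    rewrite al_eq0 mulr0; apply: cvg_trans; apply: near_eq_cvg.
    apply: filterS j_gt0 => k k0 /=.
    by rewrite -(prednK k0) exprS mulKf// gt_eqF.
  have [|BlF [ul ulF]] := selF l; first by near=> k; rewrite leq_pred.
  have tF := trialF l 0 lF; rewrite scale0r add0r subr0 scale1r in tF.
  have AtF : A i (trial theta x J k (l k) i) @[k --> F] --> A i xs.
    by apply: (single_valued_continuous Amax BD BlF Bxs tF).
  have Bul : B i xs ul by apply: (maximal_monotone_closed Bmax BlF tF ulF).
  apply: (@rejected_fixed _ _ (B i) (A i xs) ul xs yl bl delta) => //.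
    exact: Bmax.1.
  have limL : beta k * dot (A i (trial theta x J k (l k) i) + u k (l k) i)
      (x k - J k i) @[k --> F] --> bl * dot (A i xs + ul) (xs - yl).
    by apply: cvgM bF _; apply: dot_cvg dF; exact: cvgD.
  have limR : delta * dot (x k - J k i) (x k - J k i) @[k --> F] -->
      delta * dot (xs - yl) (xs - yl).
    by apply: cvgM; [exact: cvg_cst | exact: dot_cvg].
  apply: (ler_cvg_to limL limR).
  apply: filterS2 nfixF j_gt0 => k kn k0.
  have := run_reject run kn (_ : (l k < j k i)%N).
  rewrite /accepted prednK// => /(_ (leqnn _)) /negP; rewrite -ltNge enorm_sqr.
  move=> /ltW; rewrite -(ler_pM2l (b0 k)) => /le_trans; apply.
  by rewrite mulrA mulrCA divff ?mulr1// gt_eqF.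
have [|BlF [ul ulF]] := selF (fun k => j k i); first by near=> k.
have tF := trialF _ _ alF.
have Btl : B i (al *: yl + (1 - al) *: xs) ul.
  by apply: (maximal_monotone_closed Bmax BlF tF ulF).
have AtF : A i (trial theta x J k (j k i) i) @[k --> F] -->
    A i (al *: yl + (1 - al) *: xs).
  by apply: (single_valued_continuous Amax BD BlF Btl tF).
have adl0 : 0 < al * delta by rewrite mulr_gt0// lt_def al_neq0.
apply/esym/eqP; rewrite -subr_eq0; apply/eqP/dot_le0_eq0.
rewrite -(pmulr_rle0 _ adl0).
have limL : theta ^+ j k i * delta * dot (x k - J k i) (x k - J k i)
    @[k --> F] --> al * delta * dot (xs - yl) (xs - yl).
  by apply: cvgM; [apply: cvgM => //; exact: cvg_cst | exact: dot_cvg].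
have limR : beta k * dot (A i (trial theta x J k (j k i) i) + u k (j k i) i)
    (x k - z k) @[k --> F] --> (0 : R).
  have <- : bl * dot (A i (al *: yl + (1 - al) *: xs) + ul) (xs - xs) = 0.
    by rewrite subrr -(scale0r ul) dotZr mul0r mulr0.
  by apply: cvgM bF _; apply: dot_cvg; [exact: cvgD | exact: cvgB].
apply: (ler_cvg_to limL limR).
apply: filterS nfixF => k kn.
have acc := run_accept run kn.
have sep := zH k i kn.
move: acc sep; rewrite /accepted /halfspace /= enorm_sqr.
set g := A i _ + _; rewrite /trial.
(* Since z k lies in the half-space through the accepted point, the advance
   along x k - J k i is paid for by x k - z k. *)
have -> : z k - (theta ^+ j k i *: J k i + (1 - theta ^+ j k i) *: x k) =
    theta ^+ j k i *: (x k - J k i) - (x k - z k).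
  by apply/rowP => r; rewrite !mxE; ring.
move=> acc; rewrite [X in X <= 0]dotDr dotNr dotZr subr_le0 => sep.
apply: le_trans (ler_wpM2l (ltW (b0 k)) sep).
rewrite mulrCA -mulrA; apply: ler_wpM2l; first by rewrite exprn_ge0// ltW.
apply: le_trans (ler_wpM2l (ltW (b0 k)) acc).
by rewrite mulrA mulrCA divff ?mulr1// gt_eqF.
Unshelve. all: by end_near. Qed.

End Run.

(** * Convergence *)

Lemma dot_cvg0 (R : realType) (n : nat) (v : nat -> 'rV[R]_n)
    (F : set_system nat) {FF : Filter F} :
  dot (v k) (v k) @[k --> F] --> (0 : R) -> v @ F --> (0 : 'rV[R]_n).
Proof.
move=> v0; apply/cvgr0Pnorm_le => e e0.
have : \forall k \near F, dot (v k) (v k) <= e ^+ 2.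
  by apply: cvgr_le v0 _ _; rewrite exprn_gt0.
by apply: filterS => k; apply: norm_le_dot; exact: ltW.
Qed.

Lemma decreasing_dot_cvg (R : realType) (n : nat) (v : nat -> 'rV[R]_n) :
  (forall k, dot (v k.+1) (v k.+1) <= dot (v k) (v k)) ->
  exists l : R, dot (v k) (v k) @[k --> \oo] --> l.
Proof.
move=> dec; eexists.
apply: (@nonincreasing_is_cvgn _ (fun k => dot (v k) (v k))).
  by apply/nonincreasing_seqP.
by exists 0 => _ [k _ <-]; exact: dot_ge0.
Qed.

Theorem theorem4p8 (R : realType) (n m : nat)
    (domA : 'I_m -> set 'rV[R]_n) (A : 'I_m -> 'rV[R]_n -> 'rV[R]_n)
    (B : 'I_m -> 'rV[R]_n -> set 'rV[R]_n) (X : set 'rV[R]_n)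
    (beta : nat -> R) (bmin bmax theta delta rho : R)
    (x : nat -> 'rV[R]_n) (J : nat -> 'I_m -> 'rV[R]_n)
    (j : nat -> 'I_m -> nat) (u : nat -> nat -> 'I_m -> 'rV[R]_n) :
  let Sstar := \bigcap_(i in [set: 'I_m])
    zeros (op_add (pt_op (domA i) (A i)) (B i)) in
  (forall i, maximal_monotone (pt_op (domA i) (A i))) ->
  (forall i, maximal_monotone (B i)) ->
  (forall i, dom (B i) `<=` dom (pt_op (domA i) (A i))) ->
  X !=set0 -> closed X -> convex_set X ->
  X `<=` \bigcap_(i in [set: 'I_m]) dom (B i) ->
  X `&` Sstar !=set0 ->
  (forall i, bounded_selection (B i)) ->
  0 < bmin -> bmin <= bmax -> (forall k, bmin <= beta k <= bmax) ->
  0 < theta < 1 -> 0 < delta < 1 ->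
  admissible_radius B theta rho x J j ->
  variantA1_run A B X beta theta delta rho x J j u ->
  exists2 xs, (Sstar `&` X) xs & x @ \oo --> xs.
Proof.
move=> Sstar Amax Bmax BA _ Xcl Xcvx XB [s [Xs Ss]] _ bm0 _ bb th de _ run.
have BD i : dom (B i) `<=` domA i by move=> y /BA [w [Dy _]].
have SstarP y : Sstar y <-> forall i, B i y (- A i y).
  split=> [Sy i|By i _]; first by apply/(zerosP _ _ (BD i)); exact: Sy.
  exact/(zerosP _ _ (BD i)).
have Amon i y w v v' : B i y v -> B i w v' ->
    0 <= dot (y - w) (A i y - A i w).
  move=> By Bw; apply: (Amax i).1; split=> //; apply: BD.
    by exists v.
  by exists v'.
have Xx k : X (x k).
  case: k => [|k]; first exact: run_start run.
  by have [z zH [Xz _]] := run_next run k.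
have /choice[z zP] k : exists z,
    is_proj (separating_set A theta x J j u k) (x k) z /\ is_proj X z (x k.+1).
  by have [z zH zX] := run_next run k; exists z.
have fejer y : X y -> (forall i, B i y (- A i y)) -> forall k,
    dot (x k.+1 - y) (x k.+1 - y) + dot (x k - z k) (x k - z k) <=
    dot (x k - y) (x k - y).
  move=> Xy By k; have [zH zX] := zP k.
  apply: (run_step_fejer Xcvx _ _ Xy By run zH zX) => i.
    exact: (Bmax i).1.
  by move=> w v; exact: Amon.
have decr y : X y -> (forall i, B i y (- A i y)) -> forall k,
    dot (x k.+1 - y) (x k.+1 - y) <= dot (x k - y) (x k - y).
  by move=> Xy By k; apply: le_trans (fejer y Xy By k); rewrite lerDl dot_ge0.
have Bs := (SstarP s).1 Ss.
(* |x^k - z^k|^2 is at most the decrease of |x^k - s|^2. *)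
have xz0 : (fun k => x k - z k) @ \oo --> (0 : 'rV[R]_n).
  have [l dl] := decreasing_dot_cvg (decr s Xs Bs).
  apply: dot_cvg0.
  have dd : dot (x k - s) (x k - s) - dot (x k.+1 - s) (x k.+1 - s)
      @[k --> \oo] --> (0 : R).
    rewrite -(subrr l); apply: cvgB => //.
    by have := dl; rewrite -cvg_shiftS.
  apply: squeeze_cvgr (cvg_cst 0) dd.
  near=> k; rewrite dot_ge0/= lerBrDl; exact: fejer.
have [F [FU ooF]] := ultraFilterLemma eventually_filter.
have [|l lF] := @ultra_bounded_cvg _ _ F _ (fun k => x k - s)
  (dot (x 0%N - s) (x 0%N - s)).
  near=> k; have /nonincreasing_seqP := decr s Xs Bs; exact.
pose xs := l + s.
have xF : x @ F --> xs.
  have -> : x = (fun k => x k - s + s) by apply/funext => k; rewrite subrK.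
  by apply: cvgD => //; exact: cvg_cst.
have Xxs : X xs by apply: (closed_cvg X Xcl _ _ xF); near=> k.
have zF : z @ F --> xs.
  have -> : z = (fun k => x k - (x k - z k)).
    by apply/funext => k; rewrite subKr.
  rewrite -[xs]subr0; apply: cvgB => //.
  by apply: cvg_trans xz0; apply: cvg_app.
have Bxs i : B i xs (- A i xs).
  have [vs Bvs] := XB _ Xxs i I.
  apply: (run_cluster_zero (Amax i) (Bmax i) (BD i) _ Bvs bm0 bb th de run _
    xF zF).
    by move=> k; exact: XB.
  by move=> k; exact: (zP k).1.1.
exists xs; first by split=> //; exact/SstarP.
(* Fejer monotonicity with respect to xs itself makes |x^k - xs|^2 converge;
   its limit can be computed along F, where it is 0. *)
have [d dd] := decreasing_dot_cvg (decr xs Xxs Bxs).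
have dF : dot (x k - xs) (x k - xs) @[k --> F] --> d.
  by apply: cvg_trans dd; apply: cvg_app.
have d0F : dot (x k - xs) (x k - xs) @[k --> F] --> dot (xs - xs) (xs - xs).
  by apply: dot_cvg; apply: cvgB => //; exact: cvg_cst.
have d0 : d = 0.
  rewrite (cvg_unique (@Rhausdorff R) dF d0F) subrr.
  by rewrite -[X in dot X _](scale0r xs) dotZl mul0r.
rewrite d0 in dd.
have -> : x = (fun k => x k - xs + xs) by apply/funext => k; rewrite subrK.
rewrite -[X in _ --> X]add0r; apply: cvgD; last exact: cvg_cst.
exact: dot_cvg0.
Unshelve. all: by end_near. Qed.
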